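(* Let $k\ge 2$ be a fixed integer and assume the Unbalanced Supersaturation Conjecture for this $k$: there is a constant $c_k>0$ such that every bipartite graph with bipartition $A\sqcup B$, $m$ edges and $t$ cycles of length $2k$, with $m\ge 100k(|A|+|B|+(|A||B|)^{(k+1)/(2k)})$, satisfies $t\ge c_k\, m^{2k}/(|A|^k|B|^k)$. Let $G$ be a graph with $m$ edges, $t$ cycles of length $2k$, and maximum degree $\Delta(G)\le m^{2/(k+1)}$. Fix $A\subseteq V(G)$ and $d\le\Delta(G)$, and let $B$ be the set of vertices $v\in V(G)$ with $|N(v)\cap A|\in[d/2,d]$. Then \[ \frac{d\sqrt{|B|}}{\sqrt{|A|}}\le \widetilde{O}\!\left(m^{1/(k+1)}+t^{1/(2k)}\right). \]
   Context: $N(v)$ is the neighborhood of $v$. $\widetilde{O}$ hides polylogarithmic factors and constants depending on $k$. *)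

(* Defs.v *)
From mathcomp Require Import all_boot all_order all_algebra.
From mathcomp Require Import reals exp.

Set Implicit Arguments.
Unset Strict Implicit.
Unset Printing Implicit Defensive.

Import Order.TTheory GRing.Theory Num.Theory.

Record sgraph := SGraph {
  vertex :> finType;
  adj : rel vertex;
  adj_sym : symmetric adj;
  adj_irrefl : irreflexive adj
}.

Section Graph.
Variable G : sgraph.

Definition neighborhood (v : G) : {set G} := [set w | adj v w].

Definition max_degree : nat := \max_(v : G) #|neighborhood v|.

Definition edges : {set {set G}} :=
  [set E : {set G} | [exists x, exists y, adj x y && (E == [set x; y])]].

Definition edges_of_cycle (p : seq G) : {set {set G}} :=
  [set [set x; next p x] | x in p].

(* A cycle is a subgraph, recorded by its edge set, so that the choice of a   *)
(* starting vertex and of a direction is not counted. For l >= 3 the edge set *)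
(* determines the cycle.                                                      *)
Definition cycles_of_length (l : nat) : {set {set {set G}}} :=
  [set edges_of_cycle p | p : l.-tuple G & ucycleb (@adj G) p].

Definition bipartition (A B : {set G}) : Prop :=
  [/\ A :|: B = [set: G], [disjoint A & B] &
      forall x y : G, adj x y ->
        (x \in A) && (y \in B) || (x \in B) && (y \in A)].

End Graph.

Local Open Scope ring_scope.

Definition unbalanced_supersaturation (R : realType) (k : nat) : Prop :=
  exists2 c : R, 0 < c &
    forall (G : sgraph) (A B : {set G}), bipartition A B ->
      let a := #|A|%:R : R in
      let b := #|B|%:R : R in
      let m := #|edges G|%:R : R in
      let t := #|cycles_of_length G (2 * k)|%:R : R in
      100 * k%:R * (a + b + (a * b) `^ ((k + 1)%:R / (2 * k)%:R)) <= m ->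
      c * (m ^+ (2 * k) / (a ^+ k * b ^+ k)) <= t.

Definition degree_class (R : realType) (G : sgraph) (A : {set G}) (d : R) :
    {set G} :=
  [set v : G | d / 2 <= #|neighborhood v :&: A|%:R <= d].

(* Main.v *)
Require Import Defs.
From mathcomp Require Import all_boot all_order all_algebra.
From mathcomp Require Import reals exp.
From mathcomp Require Import ring lra.

Set Implicit Arguments.
Unset Strict Implicit.

Import Order.TTheory GRing.Theory Num.Theory.
Local Open Scope ring_scope.

(**
Averaging over vertex subsets [X], some cut keeps a quarter of the pairs
[(x, y)] with [x \in A], [y \in B], [adj x y]; this gives a genuine bipartite
subgraph [H] of [G] with parts inside [A] and [B] and at least [d |B| / 8]
edges. If supersaturation applies to [H], the [2k]-cycles of [H] account for
the term [t ^ (1/2k)]. Otherwise [S = d |B|] is at most a constant times [|A|],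
[|B|] or [(|A||B|) ^ ((k+1)/2k)]. Since [x = d sqrt |B| / sqrt |A|] satisfies
[x^2 = d S / |A|], the first two cases follow from [d <= Delta] and
[S <= 2 |A| Delta]; in the third one [x = S / sqrt (|A||B|)] and [S <= 8 m]
give [x^(k+1) = O(m)]. No logarithmic factor is lost.
*)

(** * Edge and cycle counts under injective homomorphisms *)

Section Embedding.
Variables (H G : sgraph) (f : H -> G).
Hypotheses (f_inj : injective f)
  (f_adj : forall x y : H, adj x y -> adj (f x) (f y)).

Lemma edges_embedding : (#|edges H| <= #|edges G|)%N.
Proof.
rewrite -(card_imset _ (imset_inj f_inj)); apply/subset_leq_card/subsetP => E.
case/imsetP => F; rewrite inE => /existsP[x /existsP[y /andP[xy /eqP->]]] ->.
rewrite inE; apply/existsP; exists (f x); apply/existsP; exists (f y).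
by rewrite f_adj //= imsetU !imset_set1.
Qed.

Lemma edges_of_cycle_map (p : seq H) : uniq p ->
  edges_of_cycle (map f p) = [set f @: E | E : {set H} in edges_of_cycle p].
Proof.
move=> Up; apply/setP => E; apply/imsetP/imsetP.
  case=> _ /mapP[x xp ->] ->; exists [set x; next p x]; first exact: imset_f.
  by rewrite next_map // imsetU !imset_set1.
case=> _ /imsetP[x xp ->] ->; exists (f x); first exact: map_f.
by rewrite next_map // imsetU !imset_set1.
Qed.

Lemma cycles_embedding (l : nat) :
  (#|cycles_of_length H l| <= #|cycles_of_length G l|)%N.
Proof.
(* A cycle is a set of edges and an edge a set of vertices, so [f] acts through two nested
   images. *)
rewrite -(card_imset _ (imset_inj (imset_inj f_inj))).
apply/subset_leq_card/subsetP => E /imsetP[_ /imsetP[p + ->] ->].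
rewrite !inE => /andP[pc pu].
apply/imsetP; exists (map_tuple f p); last by rewrite edges_of_cycle_map.
rewrite !inE /ucycleb /= map_inj_uniq // pu andbT.
exact: (homo_cycle f_adj).
Qed.

End Embedding.

(** * Averaging over cuts *)

Lemma card_separating (T : finType) (x y : T) : x != y ->
  (4 * #|[set X : {set T} | (x \in X) && (y \notin X)]| = 2 ^ #|T|)%N.
Proof.
move=> xy.
have -> : [set X : {set T} | (x \in X) && (y \notin X)] =
          [set x |: Y | Y in powerset (~: [set x; y])].
  apply/setP => X; rewrite inE; apply/andP/imsetP.
    case=> xX yX; exists (X :\ x); last by rewrite setD1K.
    rewrite powersetE; apply/subsetP => z; rewrite !inE => /andP[zx zX].
    by rewrite negb_or zx; apply: contraNneq yX => <-.
  case=> Y; rewrite powersetE => /subsetP sY ->; rewrite !inE eqxx eq_sym.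
  rewrite (negbTE xy); split=> //=; apply/negP => /sY.
  by rewrite !inE eqxx orbT.
rewrite card_in_imset; last first.
  move=> Y Z; rewrite !powersetE => /subsetP sY /subsetP sZ eYZ.
  have notin (W : {set T}) : {subset W <= ~: [set x; y]} -> x \notin W.
    by move=> sW; apply/negP => /sW; rewrite !inE eqxx.
  by rewrite -(setU1K (notin _ sY)) eYZ setU1K ?notin.
rewrite card_powerset -(cardsC [set x; y]) cards2 xy.
by rewrite expnD.
Qed.

(** Each pair of distinct points is separated, in the given order, by exactly a quarter of all [X].
    If every [X] kept less than a quarter of [P], summing over [X] and exchanging the sums would
    give a contradiction. *)
Lemma exists_cut (T : finType) (P : {set T * T}) :
  (forall p, p \in P -> p.1 != p.2) ->
  exists X : {set T},
    (#|P| <= 4 * #|[set p in P | (p.1 \in X) && (p.2 \notin X)]|)%N.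
Proof.
move=> irrP; apply/existsP; rewrite -[X in is_true X]negbK negb_exists.
apply/negP => /forallP noX.
suff : (\sum_(X : {set T})
    4 * #|[set p in P | (p.1 \in X) && (p.2 \notin X)]| <
    \sum_(X : {set T}) #|P|)%N.
  rewrite sum_nat_const -cardsT -powersetT card_powerset cardsT -big_distrr /=.
  under eq_bigr => X _ do rewrite -sum1dep_card big_mkcondr /=.
  rewrite exchange_big /= big_distrr /=.
  rewrite (eq_bigr (fun=> 2 ^ #|T|)%N) => [|p /irrP pP].
    by rewrite sum_nat_const mulnC ltnn.
  by rewrite -(card_separating pP) -big_mkcond sum1dep_card.
(* A strict inequality of sums needs one index that surely exists; [set0] is one for every [T]. *)
rewrite (bigD1 set0) //= [X in (_ < X)%N](bigD1 set0) //=.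
rewrite -addSn leq_add //; first by rewrite ltnNge.
by apply: leq_sum => X _; rewrite ltnW // ltnNge.
Qed.

(** * Ordered adjacent pairs *)

Definition adj_pairs (G : sgraph) (A B : {set G}) : {set G * G} :=
  [set p | [&& p.1 \in A, p.2 \in B & adj p.1 p.2]].

(** As the pairs are ordered, the double count is exact even when [A] and [B] overlap: an edge
    inside [A :&: B] counts once from each end. *)
Lemma card_adj_pairs (G : sgraph) (A B : {set G}) :
  #|adj_pairs A B| = (\sum_(y in B) #|neighborhood y :&: A|)%N.
Proof.
rewrite -sum1dep_card -(pair_big_dep xpredT
  (fun x y => [&& x \in A, y \in B & adj x y]) (fun _ _ => 1%N)) /=.
rewrite (exchange_big_dep (mem B)) /=; last by move=> x y _ /and3P[].
apply: eq_bigr => y yB; rewrite -sum1_card; apply: eq_bigl => x.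
by rewrite !inE yB adj_sym andbC.
Qed.

Lemma card_adj_pairsC (G : sgraph) (A B : {set G}) :
  #|adj_pairs A B| = #|adj_pairs B A|.
Proof.
have swapK : involutive (fun p : G * G => (p.2, p.1)) by case.
rewrite -(card_imset _ (inv_inj swapK)); congr #|pred_of_set _|.
apply/setP => -[x y]; rewrite inE /=; apply/imsetP/and3P.
  by case=> -[u v]; rewrite inE /= adj_sym => /and3P[? ? ?] [-> ->].
by case=> xB yA xy; exists (y, x); rewrite // inE /= yA xB adj_sym.
Qed.

Lemma card_adj_pairs_max_degree (G : sgraph) (A B : {set G}) :
  (#|adj_pairs A B| <= #|A| * max_degree G)%N.
Proof.
rewrite card_adj_pairsC card_adj_pairs -sum_nat_const; apply: leq_sum => x _.
apply: leq_trans (leq_bigmax x); exact/subset_leq_card/subsetIl.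
Qed.

(** * The bipartite subgraph between two vertex sets *)

Section BipartiteSubgraph.
Variables (G : sgraph) (A B : {set G}).

(** Restricting to a subtype discards the other vertices, since [bipartition] asks the two parts to
    cover the whole graph. *)
Definition between_vertex : finType := {x : G | x \in A :|: B}.

Definition between_adj : rel between_vertex := fun u v =>
  adj (val u) (val v) &&
  ((val u \in A) && (val v \in B) || (val u \in B) && (val v \in A)).

Lemma between_adj_sym : symmetric between_adj.
Proof.
move=> u v; rewrite /between_adj adj_sym orbC.
by rewrite [(val u \in B) && _]andbC [(val u \in A) && _]andbC.
Qed.

Lemma between_adj_irrefl : irreflexive between_adj.
Proof. by move=> u; rewrite /between_adj adj_irrefl. Qed.

Definition between : sgraph := SGraph between_adj_sym between_adj_irrefl.

Lemma edges_between : (#|edges between| <= #|edges G|)%N.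
Proof.
apply: (@edges_embedding between G (fun u => val u)); first exact: val_inj.
by move=> u v /andP[].
Qed.

Lemma cycles_between (l : nat) :
  (#|cycles_of_length between l| <= #|cycles_of_length G l|)%N.
Proof.
apply: (@cycles_embedding between G (fun u => val u)); first exact: val_inj.
by move=> u v /andP[].
Qed.

Definition between_part (D : {set G}) : {set between} :=
  [set u | val u \in D].

Lemma card_between_part (D : {set G}) : (#|between_part D| <= #|D|)%N.
Proof.
rewrite -(card_imset _ val_inj); apply/subset_leq_card/subsetP => x.
by case/imsetP => u; rewrite inE => uD ->.
Qed.

Hypothesis disjAB : [disjoint A & B].

Lemma bipartition_between :
  bipartition (between_part A) (between_part B).
Proof.
split.
- by apply/setP => u; have := valP u; rewrite !inE.
- rewrite disjoint_subset; apply/subsetP => u; rewrite !inE => uA.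
  by rewrite (disjointFr disjAB uA).
- by move=> u v /andP[_]; rewrite !inE.
Qed.

Lemma adj_pairs_sub_between :
  (#|adj_pairs A B| <= #|adj_pairs (between_part A) (between_part B)|)%N.
Proof.
pose g (p : between * between) := (val p.1, val p.2).
have g_inj : injective g by case=> u v [u' v'] [/val_inj-> /val_inj->].
rewrite -(card_imset _ g_inj); apply/subset_leq_card/subsetP => -[x y].
rewrite inE /= => /and3P[xA yB xy].
have xAB : x \in A :|: B by rewrite inE xA.
have yAB : y \in A :|: B by rewrite inE yB orbT.
apply/imsetP; exists (exist _ x xAB, exist _ y yAB) => //.
by rewrite !inE /= xA yB /= /between_adj /= xy xA yB.
Qed.

End BipartiteSubgraph.

(** With disjoint sides, an edge remembers its ordered pair: only one of its ends lies in [A]. *)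
Lemma card_adj_pairs_disjoint (G : sgraph) (A B : {set G}) :
  [disjoint A & B] -> (#|adj_pairs A B| <= #|edges G|)%N.
Proof.
move=> dAB; pose g (p : G * G) := [set p.1; p.2].
have g_inj : {in adj_pairs A B &, injective g}.
  move=> [x y] [x' y']; rewrite !inE /= => /and3P[xA yB _] /and3P[xA' yB' _] e.
  have : x \in g (x', y') by rewrite -e !inE eqxx.
  rewrite !inE /= => /orP[/eqP ->|/eqP xy']; last first.
    by move: yB'; rewrite -xy' (disjointFr dAB xA).
  have : y \in g (x', y') by rewrite -e !inE eqxx orbT.
  rewrite !inE /= => /orP[/eqP yx'|/eqP -> //].
  by move: yB; rewrite yx' (disjointFr dAB xA').
rewrite -(card_in_imset g_inj); apply/subset_leq_card/subsetP => E.
case/imsetP => -[x y]; rewrite !inE /= => /and3P[_ _ xy] ->.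
by apply/existsP; exists x; apply/existsP; exists y; rewrite xy eqxx.
Qed.

(** A good cut [X] gives the sides [A :&: X] and [B :\: X], disjoint even if [A] and [B] meet. Here
    [e] counts the pairs kept; its bound by [#|A'| * #|B'|] serves to deduce that both sides are
    nonempty. *)
Lemma exists_bipartite_subgraph (G : sgraph) (A B : {set G}) :
  exists (H : sgraph) (A' B' : {set H}), bipartition A' B' /\
    [/\ (#|A'| <= #|A|)%N, (#|B'| <= #|B|)%N,
        (#|edges H| <= #|edges G|)%N,
        forall l, (#|cycles_of_length H l| <= #|cycles_of_length G l|)%N &
        exists e : nat, [/\ (#|adj_pairs A B| <= 4 * e)%N,
          (e <= #|A'| * #|B'|)%N & (e <= #|edges H|)%N]].
Proof.
have [|X cutX] := @exists_cut _ (adj_pairs A B).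
  move=> [x y]; rewrite inE /= => /and3P[_ _ xy].
  by apply: contraTneq xy => ->; rewrite adj_irrefl.
have dAB : [disjoint A :&: X & B :\: X].
  rewrite disjoint_subset; apply/subsetP => x.
  by rewrite !inE => /andP[_ ->].
have bip := bipartition_between dAB.
exists (between (A :&: X) (B :\: X)), (between_part _ _ (A :&: X)),
  (between_part _ _ (B :\: X)); split=> //; split.
- apply: leq_trans (card_between_part _ _ _) _.
  exact/subset_leq_card/subsetIl.
- apply: leq_trans (card_between_part _ _ _) _.
  exact/subset_leq_card/subsetDl.
- exact: edges_between.
- exact: cycles_between.
exists #|adj_pairs (between_part (A :&: X) (B :\: X) (A :&: X))
                   (between_part _ _ (B :\: X))|; split.
- apply: leq_trans cutX _; rewrite leq_mul2l /=.
  apply: leq_trans (adj_pairs_sub_between _ _).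
  apply/subset_leq_card/subsetP => -[x y]; rewrite !inE /=.
  by case/andP=> /and3P[-> -> ->] /andP[-> ->].
- rewrite -cardsX; apply/subset_leq_card/subsetP => -[x y].
  by rewrite !inE /= => /and3P[-> ->].
- by apply: card_adj_pairs_disjoint; case: bip.
Qed.

(** * Real estimates for the ratio [d * Num.sqrt b / Num.sqrt a] *)

Section RealBounds.
Variable R : realType.
Implicit Types (x y z d K a b M t : R) (n k : nat).

Lemma powR_invn_exp y n : 0 <= y -> (0 < n)%N ->
  (y `^ (1 / n%:R)) ^+ n = y.
Proof.
move=> y0 n0; rewrite -powR_mulrn ?powR_ge0 // -powRrM.
by rewrite div1r mulVf ?powRr1 // pnatr_eq0 -lt0n.
Qed.

Lemma le_powR_invn x y z n : 0 <= x -> 0 <= y -> 0 <= z -> (0 < n)%N ->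
  x ^+ n <= z ^+ n * y -> x <= z * y `^ (1 / n%:R).
Proof.
move=> x0 y0 z0 n0 h.
rewrite -(@ler_pXn2r _ n) ?nnegrE ?mulr_ge0 ?powR_ge0 //.
by rewrite exprMn powR_invn_exp.
Qed.

Lemma sqr_ratio d a b : 0 < a -> 0 <= b ->
  (d * Num.sqrt b / Num.sqrt a) ^+ 2 = d * (d * b) / a.
Proof.
move=> a0 b0; rewrite !exprMn exprVn !sqr_sqrtr // ?ltW //.
by rewrite expr2 !mulrA.
Qed.

Lemma ratioE d a b : 0 < a -> 0 < b ->
  d * Num.sqrt b / Num.sqrt a = d * b / Num.sqrt (a * b).
Proof.
move=> a0 b0; rewrite sqrtrM ?ltW //.
have ra0 : Num.sqrt a != 0 by rewrite gt_eqF ?sqrtr_gt0.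
have rb0 : Num.sqrt b != 0 by rewrite gt_eqF ?sqrtr_gt0.
move: rb0 ra0 (sqr_sqrtr (ltW b0)); move: (Num.sqrt a) (Num.sqrt b) => ra rb.
by move=> rb0 ra0 <-; field; apply/andP.
Qed.

(** The [2k]-th power of the ratio is [(d * b) ^+ (2 * k) / (a ^+ k * b ^+ k)], the shape of the
    supersaturation bound; passing to the smaller [a'] and [b'] only increases it. *)
Lemma ratio_le_cycles d a b a' b' e t c k : (0 < k)%N -> 0 < c ->
  0 <= d -> 0 < a' -> a' <= a -> 0 < b' -> b' <= b ->
  0 <= e -> d * b <= 8 * e ->
  c * (e ^+ (2 * k) / (a' ^+ k * b' ^+ k)) <= t ->
  d * Num.sqrt b / Num.sqrt a
    <= (8 * c^-1 `^ (1 / (2 * k)%:R)) * t `^ (1 / (2 * k)%:R).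
Proof.
move=> k0 c0 d0 a'0 a'a b'0 b'b e0 dbe h.
have a0 : 0 < a by apply: lt_le_trans a'a.
have b0 : 0 < b by apply: lt_le_trans b'b.
have t0 : 0 <= t.
  apply: le_trans h; rewrite mulr_ge0 ?(ltW c0) // divr_ge0 ?exprn_ge0 //.
  by rewrite mulr_ge0 // exprn_ge0 // ltW.
apply: le_powR_invn => //; rewrite ?mulr_ge0 ?powR_ge0 ?invr_ge0 ?sqrtr_ge0 //.
  by rewrite muln_gt0.
rewrite [in leRHS]exprMn powR_invn_exp ?invr_ge0 ?(ltW c0) ?muln_gt0 //.
rewrite [in leLHS]exprM sqr_ratio ?(ltW b0) //.
have -> : (d * (d * b) / a) ^+ k = (d * b) ^+ (2 * k) / (a ^+ k * b ^+ k).
  rewrite exprM -exprMn -expr_div_n; congr (_ ^+ k).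
  by field; rewrite !gt_eqF.
apply: (@le_trans _ _ (8 ^+ (2 * k) * (e ^+ (2 * k) / (a' ^+ k * b' ^+ k)))).
  rewrite mulrA -[8 ^+ _ * _]exprMn; apply: ler_pM.
  - by apply/exprn_ge0/mulr_ge0; rewrite // ltW.
  - by rewrite invr_ge0 ltW // mulr_gt0 // exprn_gt0.
  - by rewrite lerXn2r ?nnegrE ?mulr_ge0 // ltW.
  rewrite lef_pV2 ?posrE ?mulr_gt0 ?exprn_gt0 //.
  by apply: ler_pM; rewrite ?exprn_ge0 ?lerXn2r ?nnegrE // ltW.
by rewrite -[leRHS]mulrA ler_pM2l ?exprn_gt0 // ler_pdivlMl.
Qed.

(** The squared ratio is [d * (d * b) / a]. One factor is bounded through [K] and the other through
    [D], which gives at most [2 * K * D] in both cases. *)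
Lemma ratio_le_sqrt d a b K D y : 0 < a -> 0 <= b -> 0 <= d -> 0 <= y ->
  1 <= K -> d <= D -> d * b <= 2 * (a * D) -> D <= y ^+ 2 ->
  d * b <= K * a \/ d <= K ->
  d * Num.sqrt b / Num.sqrt a <= 8 * K * y.
Proof.
move=> a0 b0 d0 y0 K1 dD dbD Dy h.
have K0 : 0 <= K by apply: le_trans K1.
rewrite -(@ler_pXn2r _ 2) ?nnegrE ?mulr_ge0 ?invr_ge0 ?sqrtr_ge0 //.
rewrite sqr_ratio // ler_pdivrMr //.
have D0 : 0 <= D by apply: le_trans dD.
have aD0 : 0 <= a * D by rewrite mulr_ge0 // ltW.
have step : d * (d * b) <= 2 * K * (a * D).
  case: h => h.
    have := ler_pM d0 (mulr_ge0 d0 b0) dD h.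
    have := mulr_ge0 K0 aD0; lra.
  by have := ler_pM d0 (mulr_ge0 d0 b0) h dbD; lra.
apply: le_trans step _.
have -> : (8 * K * y) ^+ 2 * a = 64 * K ^+ 2 * (a * y ^+ 2) by ring.
apply: ler_pM => //; rewrite ?mulr_ge0 //; first by nra.
by rewrite ler_pM2l.
Qed.

(** With [u = Num.sqrt (a * b)] the last hypothesis says [(d * b) ^+ k <= K ^+ k * u ^+ (k + 1)].
    One more factor [d * b <= 8 * M] bounds the [(k + 1)]-st power of the ratio by
    [8 * K ^+ k * M]. *)
Lemma ratio_le_root d a b K M k : (0 < k)%N -> 0 < a -> 0 < b -> 0 <= d ->
  1 <= K -> d * b <= 8 * M ->
  d * b <= K * (a * b) `^ ((k + 1)%:R / (2 * k)%:R) ->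
  d * Num.sqrt b / Num.sqrt a <= 8 * K * M `^ (1 / (k + 1)%:R).
Proof.
move=> k0 a0 b0 d0 K1 dbM h.
have K0 : 0 <= K by apply: le_trans K1.
have ab0 : 0 < a * b by rewrite mulr_gt0.
have db0 : 0 <= d * b by rewrite mulr_ge0 // ltW.
have M0 : 0 <= M by rewrite -(pmulr_rge0 _ (ltr0n R 8)); apply: le_trans dbM.
set u := Num.sqrt (a * b).
have u0 : 0 < u by rewrite sqrtr_gt0.
have dbk : (d * b) ^+ k <= K ^+ k * u ^+ (k + 1).
  have -> : u ^+ (k + 1) = ((a * b) `^ ((k + 1)%:R / (2 * k)%:R)) ^+ k.
    rewrite /u -powR12_sqrt ?ltW // -!powR_mulrn ?powR_ge0 // -!powRrM.
    congr (_ `^ _); rewrite natrM; field.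
    by rewrite pnatr_eq0 -lt0n.
  rewrite -exprMn lerXn2r ?nnegrE //.
  by rewrite mulr_ge0 // powR_ge0.
apply: le_powR_invn => //; rewrite ?mulr_ge0 ?invr_ge0 ?sqrtr_ge0 //.
  by rewrite addn1.
rewrite ratioE // -/u expr_div_n ler_pdivrMr ?exprn_gt0 //.
rewrite [X in X <= _]exprD expr1.
apply: le_trans (ler_pM (exprn_ge0 _ db0) db0 dbk dbM) _.
have -> : K ^+ k * u ^+ (k + 1) * (8 * M) = (8 * K ^+ k * M) * u ^+ (k + 1).
  by ring.
rewrite ler_pM2r ?exprn_gt0 // ler_wpM2r // exprMn.
apply: ler_pM; rewrite ?exprn_ge0 //.
  by rewrite addn1 exprS ler_peMr // exprn_ege1 // ler1n.
by rewrite addn1 exprS ler_peMl ?exprn_ge0.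
Qed.

End RealBounds.

(** * Assembly of the cases *)

Unset Implicit Arguments.

Theorem lemmaA2 (R : realType) (k : nat) (hk : (2 <= k)%N)
    (hconj : unbalanced_supersaturation R k) :
  exists (C : R) (p : nat), 0 < C /\
    forall (G : sgraph) (A : {set G}) (d : R),
      let m := #|edges G|%:R : R in
      let t := #|cycles_of_length G (2 * k)|%:R : R in
      let B := degree_class A d in
      (max_degree G)%:R <= m `^ (2 / (k + 1)%:R) ->
      d <= (max_degree G)%:R ->
      d * Num.sqrt #|B|%:R / Num.sqrt #|A|%:R
        <= C * (1 + ln (1 + m)) ^+ p
           * (m `^ (1 / (k + 1)%:R) + t `^ (1 / (2 * k)%:R)).
Proof.
have [c c0 sat] := hconj.
have k0 : (0 < k)%N by apply: leq_trans hk.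
have k1 : 1 <= k%:R :> R by rewrite ler1n.
(* This is [100 * k] from the conjecture, times 8 from [dbe], times 3 for isolating one of three
   summands. *)
pose K : R := 2400 * k%:R.
have K1 : 1 <= K by rewrite /K; lra.
pose L : R := 8 * c^-1 `^ (1 / (2 * k)%:R).
have L0 : 0 <= L by rewrite mulr_ge0 ?powR_ge0.
exists (8 * K + L), 0%N; split; first by lra.
move=> G A d m t B Dm dD; rewrite expr0 mulr1.
set y := m `^ _; set z := t `^ _.
have y0 : 0 <= y by rewrite powR_ge0.
have z0 : 0 <= z by rewrite powR_ge0.
suff : d * Num.sqrt #|B|%:R / Num.sqrt #|A|%:R <= 8 * K * y \/
       d * Num.sqrt #|B|%:R / Num.sqrt #|A|%:R <= L * z.
  have K0 : 0 <= K by lra.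
  have := mulr_ge0 K0 y0; have := mulr_ge0 K0 z0.
  have := mulr_ge0 L0 y0; have := mulr_ge0 L0 z0.
  by move=> ? ? ? ? [] ?; lra.
have rhs0 : 0 <= 8 * K * y by rewrite mulr_ge0 // mulr_ge0 //; lra.
have [d0|d0] := leP d 0.
  left; apply: le_trans rhs0.
  by rewrite -mulrA mulr_le0_ge0 // divr_ge0 ?sqrtr_ge0.
have [B0|B0] := posnP #|B|; first by left; rewrite B0 sqrtr0 mulr0 mul0r.
(* For empty [A] the quotient is 0, because the inverse of 0 is 0. *)
have [A0|A0] := posnP #|A|; first by left; rewrite A0 sqrtr0 invr0 mulr0.
have a0 : 0 < #|A|%:R :> R by rewrite ltr0n.
have b0 : 0 < #|B|%:R :> R by rewrite ltr0n.
(* The factor 2 comes from the lower end [d / 2] of the degree class. *)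
have pairs : d * #|B|%:R <= 2 * #|adj_pairs A B|%:R :> R.
  rewrite card_adj_pairs natr_sum mulr_sumr mulr_natr -sumr_const.
  by apply: ler_sum => v; rewrite inE => /andP[]; lra.
have dbD : d * #|B|%:R <= 2 * (#|A|%:R * (max_degree G)%:R) :> R.
  apply: le_trans pairs _.
  by rewrite ler_pM2l // -natrM ler_nat card_adj_pairs_max_degree.
have Dy : (max_degree G)%:R <= y ^+ 2 :> R.
  rewrite /y -powR_mulrn ?powR_ge0 // -powRrM.
  by rewrite mulrAC mul1r.
have [H [A' [B' [bip [A'A B'B HG cycHG [e [pe eAB eH]]]]]]] :=
  exists_bipartite_subgraph A B.
have dbe : d * #|B|%:R <= 8 * #|edges H|%:R :> R.
  apply: le_trans pairs _.
  have := pe; rewrite -(ler_nat R) natrM.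
  by have := eH; rewrite -(ler_nat R); lra.
have e0 : (0 < e)%N.
  rewrite -(ltr0n R); have := pe; rewrite -(ler_nat R) natrM.
  by have := mulr_gt0 d0 b0; lra.
have /andP[A'0 B'0] : (0 < #|A'|)%N && (0 < #|B'|)%N.
  by rewrite -muln_gt0 (leq_trans e0).
set a : R := #|A|%:R in a0 dbD *.
set b : R := #|B|%:R in b0 dbD dbe *.
have a'a : #|A'|%:R <= a by rewrite ler_nat.
have b'b : #|B'|%:R <= b by rewrite ler_nat.
set P := (#|A'|%:R * #|B'|%:R : R) `^ ((k + 1)%:R / (2 * k)%:R).
have [mbig|msmall] :=
  leP (100 * k%:R * (#|A'|%:R + #|B'|%:R + P)) (#|edges H|%:R).
  right; apply: (ratio_le_cycles k0 c0 (ltW d0) _ a'a _ b'b (ler0n _ _) dbe);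
    rewrite ?ltr0n //.
  by apply: le_trans (sat H A' B' bip mbig) _; rewrite ler_nat.
left.
have PQ : P <= (a * b) `^ ((k + 1)%:R / (2 * k)%:R).
  apply: ge0_ler_powR;
    rewrite ?divr_ge0 ?nnegrE ?mulr_ge0 ?(ltW a0) ?(ltW b0) //.
  by apply: ler_pM.
(* The failed edge condition for [H] passes to [a] and [b], which dominate the sizes of its
   sides. *)
have dbK : d * b < K / 3 * (a + b + (a * b) `^ ((k + 1)%:R / (2 * k)%:R)).
  apply: le_lt_trans dbe _.
  have -> : K / 3 = 8 * (100 * k%:R) by rewrite /K; field.
  rewrite -mulrA ltr_pM2l //; apply: lt_le_trans msmall _.
  by apply: ler_wpM2l; [lra | lra].
have lin : d * b <= K * a \/ d <= K ->
  d * Num.sqrt b / Num.sqrt a <= 8 * K * y.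
  exact: (ratio_le_sqrt a0 (ltW b0) (ltW d0) y0 K1 dD dbD Dy).
have [ha|ha] := leP (d * b) (K * a); first by apply: lin; left.
have [hb|hb] := leP d K; first by apply: lin; right.
apply: ratio_le_root => //; first exact: ltW.
  by apply: le_trans dbe _; rewrite ler_pM2l // ler_nat.
(* Both [K * a] and [K * b] are now below [d * b], so in [dbK] the power term alone must account for
   the remaining third. *)
have : K * b < d * b by rewrite ltr_pM2r.
by lra.
Qed.
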